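(* Let $N\ge1$ and $n_1,\dots,n_N\ge1$. Let $\rho$ be a joint state of $N$ received signals, the $l$-th signal being an $n_l$-photon signal, let $U$ be a unitary on $\mathbb{C}^2$ selecting the measurement basis $b$, and let $a_1,\dots,a_N\in\{0,1\}$ be reference bits. Consider the detection of all $N$ signals with photon-number-resolving detectors in basis $b$, together with the two post-processings (threshold-detector outcome, and Situation 2 bit $y_l$) described in the context. Then: (i) (Single-qubit description) The bits $(y_1,\dots,y_N)$ have the same distribution as the outcomes of measuring in basis $b$ the $N$ qubits of the effective single-qubit signals $\big(\Lambda_{n_1\to1}\otimes\cdots\otimes\Lambda_{n_N\to1}\big)(\rho)$. (ii) With probability one, the error rate $e_b=\frac{1}{N}\,|\{l: y_l\ne a_l\}|$ of these effective qubit signals satisfies $$\frac{N^{\mathrm{s,e}}}{N}\;\le\; e_b\;\le\;\frac{N^{\mathrm{s,e}}+N^{\mathrm{d}}}{N},$$ where $N^{\mathrm{s,e}}$ is the number of erroneous single-click events and $N^{\mathrm{d}}$ is the number of double-click events among the $N$ threshold-detector outcomes.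
   Context: Single-photon polarization states live in $\mathbb{C}^2$ with orthonormal basis $|0\rangle,|1\rangle$. An $n$-photon signal is described on the symmetric subspace $\mathrm{Sym}^n(\mathbb{C}^2)\subset(\mathbb{C}^2)^{\otimes n}$; a joint state of $N$ signals is a density operator on $\bigotimes_{l}(\mathbb{C}^2)^{\otimes n_l}$ supported on $\bigotimes_l \mathrm{Sym}^{n_l}(\mathbb{C}^2)$. The universal squash operation $\Lambda_{n\to1}$ is the partial trace over $n-1$ of the $n$ tensor factors of an $n$-photon signal (by symmetry it does not matter which). Measuring a qubit in basis $b$ means applying $U$ and then measuring in $\{|0\rangle,|1\rangle\}$. Photon-number-resolving detection of the $l$-th signal in basis $b$: apply $U$ to each of its $n_l$ photons, measure each photon in $\{|0\rangle,|1\rangle\}$, and record the numbers $(k_0^{(l)},k_1^{(l)})$, $k_0^{(l)}+k_1^{(l)}=n_l$, of photons found in $|0\rangle$ and in $|1\rangle$. From this same record two outputs are derived. Threshold-detector outcome: ''bit 0'' if $k_1^{(l)}=0$, ''bit 1'' if $k_0^{(l)}=0$ (both called single-click events), and ''double-click'' if $k_0^{(l)},k_1^{(l)}\ge1$. A single-click event ''bit $i$'' in round $l$ is erroneous if $i\ne a_l$ and correct if $i=a_l$; thus $N=N^{\mathrm{s,c}}+N^{\mathrm{s,e}}+N^{\mathrm{d}}$, where $N^{\mathrm{s,c}}$, $N^{\mathrm{s,e}}$, $N^{\mathrm{d}}$ count correct single-clicks, erroneous single-clicks and double-clicks. Situation 2 bit: given the records, independently for each $l$, $y_l=i$ with probability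 $k_i^{(l)}/n_l$, $i\in\{0,1\}$. *)

(* Defs.v *)
From HB Require Import structures.
From mathcomp Require Import all_boot all_order all_algebra all_fingroup.
From mathcomp Require Import reals complex.

Set Implicit Arguments.
Unset Strict Implicit.
Unset Printing Implicit Defensive.

Import Order.TTheory GRing.Theory Num.Theory.
Local Open Scope ring_scope.
Local Open Scope sesquilinear_scope.

(* A finite-dimensional Hilbert space is given by a finite type T indexing an
   orthonormal basis.  Its vectors are the columns 'cV_#|T| and its operators
   the matrices 'M_#|T|, with T enumerated by enum_rank.  Qubits are indexed by
   bool, |0> being false and |1> being true. *)
Notation ket R T := 'cV[complex R]_#|(T%type : finType)|.
Notation op R T := 'M[complex R]_#|(T%type : finType)|.

(* The product basis of the tensor product of the spaces with bases T i. *)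
Notation tensor T := {dffun forall i, T i}.

(* (C^2)^{(x) n} and (x)_l (C^2)^{(x) n_l}. *)
Notation qubits n := {dffun forall _ : 'I_n, bool}.
Notation signals n := {dffun forall l, qubits (n l)}.

Definition entry (R : realType) (T : finType) (A : op R T) (x y : T)
    : complex R :=
  A (enum_rank x) (enum_rank y).

Definition amplitude (R : realType) (T : finType) (v : ket R T) (x : T)
    : complex R :=
  v (enum_rank x) 0.

(* |x><y| *)
Definition ketbra (R : realType) (T : finType) (x y : T) : op R T :=
  delta_mx (enum_rank x) (enum_rank y).

Definition tensor_ket (R : realType) (I : finType) (T : I -> finType)
    (v : forall i, ket R (T i)) : ket R (tensor T) :=
  \col_p \prod_i amplitude (v i) ((enum_val p : tensor T) i).

Definition tensor_op (R : realType) (I : finType) (T : I -> finType)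
    (A : forall i, op R (T i)) : op R (tensor T) :=
  \matrix_(p, q) \prod_i entry (A i) ((enum_val p : tensor T) i)
                                     ((enum_val q : tensor T) i).

(* The tensor product of linear maps Phi i, i.e. the linear extension of
   |x><y| |-> (x)_i Phi_i (|x_i><y_i|). *)
Definition tensor_map (R : realType) (I : finType) (S T : I -> finType)
    (Phi : forall i, op R (S i) -> op R (T i)) (A : op R (tensor S))
    : op R (tensor T) :=
  \sum_(x : tensor S) \sum_(y : tensor S)
    entry A x y *: tensor_op (fun i => Phi i (ketbra R (x i) (y i))).

(* On R[i], 0 <= z means that z is real and nonnegative; in particular
   positivity of all <v|A|v> makes A Hermitian. *)
Definition density (R : realType) (T : finType) (A : op R T) : Prop :=
  (forall v : ket R T, 0 <= ((v^t*) *m A *m v) 0 0) /\ \tr A = 1.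

Definition symmetric_ket (R : realType) (n : nat) (v : ket R (qubits n))
    : Prop :=
  forall (s : 'S_n) (x : qubits n),
    amplitude v ([ffun j => x (s j)] : qubits n) = amplitude v x.

(* (x)_l Sym^{n_l}(C^2): finite sums of product vectors with symmetric
   factors. *)
Definition tensor_symmetric (R : realType) (N : nat) (n : 'I_N -> nat)
    (v : ket R (signals n)) : Prop :=
  exists (m : nat) (psi : 'I_m -> forall l, ket R (qubits (n l))),
    (forall k l, symmetric_ket (psi k l)) /\
    v = \sum_(k < m) tensor_ket (psi k).

Definition joint_state (R : realType) (N : nat) (n : 'I_N -> nat)
    (rho : op R (signals n)) : Prop :=
  density rho /\ forall v, tensor_symmetric (rho *m v).

(* Partial trace over all tensor factors but the j-th. *)
Definition squash (R : realType) (n : nat) (j : 'I_n) (A : op R (qubits n))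
    : op R bool :=
  \matrix_(a, b)
    \sum_(x : qubits n | x j == enum_val a)
    \sum_(y : qubits n | (y j == enum_val b) &&
                         [forall k, (k != j) ==> (x k == y k)])
      entry A x y.

(* Born probabilities of applying V and then measuring in the basis T. *)
Definition born (R : realType) (T : finType) (V A : op R T) (x : T) : R :=
  complex.Re (entry (V *m A *m V^t*) x x).

Definition on_each (R : realType) (n : nat) (U : op R bool)
    : op R (qubits n) :=
  tensor_op (fun _ => U).

(* A record k gives the number k i of photons found in |i>. *)
Definition record (n : nat) := {ffun bool -> 'I_n.+1}.
Notation records n := {dffun forall l, record (n l)}.

(* inord is exact here, the count being at most n. *)
Definition count_photons (n : nat) (x : qubits n) : record n :=
  [ffun i => inord #|[set j | x j == i]|].

Definition record_law (R : realType) (N : nat) (n : 'I_N -> nat)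
    (U : op R bool) (rho : op R (signals n)) (k : records n) : R :=
  \sum_(x : signals n | [forall l, count_photons (x l) == k l])
    born (tensor_op (fun l => on_each (n l) U)) rho x.

(* Joint law of the photon-number records and the Situation 2 bits. *)
Definition detection_law (R : realType) (N : nat) (n : 'I_N -> nat)
    (U : op R bool) (rho : op R (signals n)) (w : records n * qubits N) : R :=
  record_law U rho w.1 * \prod_l ((w.1 l (w.2 l))%:R / (n l)%:R).

Definition Pr (R : realType) (T : finType) (law : T -> R) (E : pred T) : R :=
  \sum_(t | E t) law t.

Variant click := SingleClick of bool | DoubleClick.

Definition threshold (n : nat) (k : record n) : click :=
  if k true == 0%N :> nat then SingleClick false
  else if k false == 0%N :> nat then SingleClick true
  else DoubleClick.

Definition is_erroneous (a : bool) (c : click) : bool :=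
  if c is SingleClick i then i != a else false.

Definition is_double (c : click) : bool :=
  if c is DoubleClick then true else false.

Definition N_se (N : nat) (n : 'I_N -> nat) (a : 'I_N -> bool)
    (k : records n) : nat :=
  #|[set l | is_erroneous (a l) (threshold (k l))]|.

Definition N_d (N : nat) (n : 'I_N -> nat) (k : records n) : nat :=
  #|[set l | is_double (threshold (k l))]|.

Definition error_rate (R : realType) (N : nat) (a : 'I_N -> bool)
    (y : qubits N) : R :=
  #|[set l | y l != a l]|%:R / N%:R.

(* Main.v *)
(** The probability that the [J l]-th photon of each signal [l] is found in
    the bit [y l] is [\sum_u \sum_v rho u v \prod_l M_l]: unitarity of [U]
    traces out all photons but the chosen ones, so that [M_l] is the
    corresponding matrix element of the squashed qubit signals. Since [rho] is
    Hermitian with range in the symmetric subspace, it is invariant under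
    permuting photons of rows and columns simultaneously, and this probability
    does not depend on [J]. The Situation 2 weight [\prod_l k_l / n_l] is an
    average over all choices of [J], whence (i). For (ii), a bit of nonzero
    weight agrees with every single click, and the bounds then hold pointwise. *)

Require Import Defs.
From mathcomp Require Import all_boot all_order all_algebra all_fingroup.
From mathcomp Require Import reals complex ring.
Import Order.TTheory GRing.Theory Num.Theory.
Local Open Scope ring_scope.
Local Open Scope sesquilinear_scope.

Set Implicit Arguments.
Unset Strict Implicit.
Unset Printing Implicit Defensive.

(** * Distributivity over dependent functions *)

Lemma bigA_distr_dffun (S : comPzSemiRingType) (I : finType) (T : I -> finType)
    (F : forall i, T i -> S) :
  \prod_i \sum_(t : T i) F i t =
  \sum_(x : {dffun forall i, T i}) \prod_i F i (x i).
Proof.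
rewrite (reindex (@dffun_of_fprod I T)) /=; last first.
  exact/onW_bij/dffun_of_fprod_bij.
pose P i : {ffun T i -> S} := [ffun t => F i t].
transitivity (\sum_(x : fprod T) \prod_(i in I) P i (x i)); last first.
  by apply: eq_bigr => x _; apply: eq_bigr => i _; rewrite !ffunE.
(* Elements of [fprod T] are ordinary functions into the tagged union sending [i] to the tag [i], so
   the default [0] is never reached. *)
rewrite big_fprod -(bigA_distr_big_dep _ (fun i => untag 0 (P i))).
apply: eq_bigr => i _; rewrite -(big_tag P).
by apply: eq_bigr => t _; rewrite ffunE.
Qed.

Lemma bigA_distr_dffun_cond (S : comPzSemiRingType) (I : finType)
    (T : I -> finType) (P : forall i, pred (T i)) (F : forall i, T i -> S) :
  \prod_i \sum_(t : T i | P i t) F i t =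
  \sum_(x : {dffun forall i, T i} | [forall i, P i (x i)]) \prod_i F i (x i).
Proof.
under eq_bigr => i _ do rewrite big_mkcond.
rewrite bigA_distr_dffun [RHS]big_mkcond; apply: eq_bigr => x _.
case: ifPn => [/forallP Px|].
  by apply: eq_bigr => i _; rewrite Px.
rewrite negb_forall => /existsP[i /negPf NPi].
by rewrite (bigD1 i) //= NPi mul0r.
Qed.

(** * Positive quadratic forms are Hermitian *)

Lemma mulmx_bilinearD (S : comPzRingType) (m : nat) (X1 X2 : 'rV[S]_m)
    (A : 'M[S]_m) (Y1 Y2 : 'cV[S]_m) (a b c d : S) :
  ((a *: X1 + b *: X2) *m A *m (c *: Y1 + d *: Y2)) 0 0 =
  a * c * (X1 *m A *m Y1) 0 0 + a * d * (X1 *m A *m Y2) 0 0 +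
  b * c * (X2 *m A *m Y1) 0 0 + b * d * (X2 *m A *m Y2) 0 0.
Proof.
rewrite [(_ + _) *m A]mulmxDl mulmxDr !mulmxDl -!scalemxAl -!scalemxAr.
rewrite !scalerA ![fun_of_matrix (_ + _) _ _]mxE.
by rewrite ![fun_of_matrix (_ *: _) _ _]mxE addrACA addrA.
Qed.

Lemma psd_hermitian (C : numClosedFieldType) (m : nat) (A : 'M[C]_m) :
  (forall v : 'cV_m, 0 <= (v^t* *m A *m v) 0 0) -> A = A^t*.
Proof.
(* Polarization: the quadratic form is real at [c e_i + d e_j] for
   [(c, d) = (1, 0), (1, 1), (1, 'i)]. *)
move=> A_ge0.
have quad (c d : C) i j : c^* * c * A i i + c^* * d * A i j +
    d^* * c * A j i + d^* * d * A j j \is Num.real.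
  have := A_ge0 (c *: delta_mx i 0 + d *: delta_mx j 0 : 'cV_m).
  have -> : (c *: delta_mx i 0 + d *: delta_mx j 0 : 'cV_m)^t* =
            c^* *: delta_mx 0 i + d^* *: delta_mx 0 j.
    apply/matrixP => k l; rewrite !mxE rmorphD !rmorphM !rmorph_nat.
    by rewrite ![(l == _) && _]andbC.
  rewrite mulmx_bilinearD => /ger0_real.
  by rewrite -!rowE -!colE !mxE.
have diag_real k : A k k \is Num.real.
  have := quad 1 0 k k.
  by rewrite !(rmorph0, rmorph1, mul0r, mulr0, mul1r, addr0).
apply/matrixP => i j; rewrite !mxE.
have sum_real : A i j + A j i \is Num.real.
  have := quad 1 1 i j; rewrite !(rmorph1, mul1r) => E.
  have -> : A i j + A j i =
      A i i + A i j + A j i + A j j - (A i i + A j j) by ring.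
  by rewrite rpredB // rpredD.
have dif_real : 'i * (A i j - A j i) \is Num.real.
  have := quad 1 'i i j; rewrite conjCi rmorph1 !mul1r !mulr1 => E.
  have -> : 'i * (A i j - A j i) =
      A i i + 'i * A i j + - 'i * A j i + - 'i * 'i * A j j -
      (A i i + - 'i * 'i * A j j) by ring.
  by rewrite rpredB // rpredD // mulNr -expr2 sqrCi opprK mul1r.
move/CrealP: sum_real; move/CrealP: dif_real.
rewrite rmorphM rmorphB rmorphD /= conjCi mulNr -mulrN.
move=> /(mulfI (neq0Ci _)) E1 E2.
(* Adding the two conjugation equations cancels [(A i j)^*]. *)
have : 2 * (A i j) = 2 * (A j i)^*.
  have -> : 2 * A i j = (A i j + A j i) + (A i j - A j i) by ring.
  by rewrite -E1 -E2; ring.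
by apply: mulfI; rewrite pnatr_eq0.
Qed.

(** * Operators by their entries, and tensor products *)

Section Operators.
Variable R : realType.
Local Notation C := (complex R).

Lemma Re_sum (I : Type) (r : seq I) (P : pred I) (F : I -> C) :
  complex.Re (\sum_(i <- r | P i) F i) = \sum_(i <- r | P i) complex.Re (F i).
Proof. by apply: (big_morph (@complex.Re R)) => // [[? ?]] []. Qed.

Lemma big_ord_enum_rank (V : nmodType) (T : finType) (F : 'I_#|T| -> V) :
  \sum_i F i = \sum_(x : T) F (enum_rank x).
Proof. by rewrite (reindex (@enum_rank T)) //; apply/onW_bij/enum_rank_bij. Qed.

Lemma entryM (T : finType) (A B : op R T) (x y : T) :
  entry (A *m B) x y = \sum_z entry A x z * entry B z y.
Proof. by rewrite /entry mxE big_ord_enum_rank. Qed.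

Lemma entryZ (T : finType) (c : C) (A : op R T) (x y : T) :
  entry (c *: A) x y = c * entry A x y.
Proof. by rewrite /entry mxE. Qed.

Lemma entry_sum (T : finType) (I : finType) (F : I -> op R T) (x y : T) :
  entry (\sum_i F i) x y = \sum_i entry (F i) x y.
Proof. by rewrite /entry summxE. Qed.

Lemma entry_adj (T : finType) (A : op R T) (x y : T) :
  entry (A ^t*) x y = (entry A y x)^*.
Proof. by rewrite /entry !mxE. Qed.

Lemma entry_ketbra (T : finType) (u v x y : T) :
  entry (ketbra R u v) x y = ((x == u) && (y == v))%:R.
Proof. by rewrite /entry mxE !(inj_eq enum_rank_inj). Qed.

Lemma entry_conj (T : finType) (V A : op R T) (x y : T) :
  entry (V *m A *m V^t*) x y =
  \sum_u \sum_v entry A u v * (entry V x u * (entry V y v)^*).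
Proof.
rewrite entryM exchange_big; apply: eq_bigr => v _.
rewrite entryM mulr_suml; apply: eq_bigr => u _.
by rewrite entry_adj -!mulrA mulrCA.
Qed.

Lemma op_eqP (T : finType) (A B : op R T) :
  (forall x y, entry A x y = entry B x y) <-> A = B.
Proof.
split=> [eqAB|-> //]; apply/matrixP => i j.
by rewrite -(enum_valK i) -(enum_valK j) -/(entry A _ _) eqAB.
Qed.

Section Tensor.
Variables (I : finType) (T : I -> finType).
Implicit Types (A B : forall i, op R (T i)) (x y u v : tensor T).

Lemma entry_tensor_op A x y :
  entry (tensor_op A) x y = \prod_i entry (A i) (x i) (y i).
Proof. by rewrite /entry mxE !enum_rankK. Qed.

Lemma tensor_opM A B :
  tensor_op A *m tensor_op B = tensor_op (fun i => A i *m B i).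
Proof.
apply/op_eqP => x y; rewrite entryM entry_tensor_op.
under [RHS]eq_bigr => i _ do rewrite entryM.
rewrite bigA_distr_dffun; apply: eq_bigr => z _.
by rewrite !entry_tensor_op -big_split.
Qed.

Lemma tensor_op_adj A : (tensor_op A)^t* = tensor_op (fun i => (A i)^t*).
Proof.
apply/op_eqP => x y; rewrite entry_adj !entry_tensor_op rmorph_prod.
by apply: eq_bigr => i _; rewrite entry_adj.
Qed.

(** For an event that constrains each factor separately, the sum over outcomes distributes over the
    product, so that each factor can be evaluated alone. *)
Lemma born_tensor_op_sum (P : forall i, pred (T i)) A (rho : op R (tensor T)) :
  \sum_(x : tensor T | [forall i, P i (x i)]) born (tensor_op A) rho x =
  complex.Re (\sum_u \sum_v entry rho u v *
     \prod_i \sum_(t | P i t) entry (A i) t (u i) * (entry (A i) t (v i))^*).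
Proof.
rewrite -Re_sum; congr complex.Re.
under eq_bigr => x _ do rewrite entry_conj.
rewrite exchange_big; apply: eq_bigr => u _.
rewrite exchange_big; apply: eq_bigr => v _.
rewrite -big_distrr bigA_distr_dffun_cond; congr (_ * _).
apply: eq_bigr => x _.
by rewrite !entry_tensor_op rmorph_prod -big_split.
Qed.

End Tensor.

(** The right-hand side has the shape of [born_tensor_op_sum], which reduces the comparison of the
    two to single factors. *)
Lemma born_tensor_map (I : finType) (S T : I -> finType)
    (Phi : forall i, op R (S i) -> op R (T i)) (A : forall i, op R (T i))
    (rho : op R (tensor S)) (y : tensor T) :
  born (tensor_op A) (tensor_map Phi rho) y =
  complex.Re (\sum_u \sum_v entry rho u v *
    \prod_i entry (A i *m Phi i (ketbra R (u i) (v i)) *m (A i)^t*) (y i) (y i)).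
Proof.
congr complex.Re; rewrite /tensor_map mulmx_sumr mulmx_suml entry_sum.
apply: eq_bigr => u _; rewrite mulmx_sumr mulmx_suml entry_sum.
apply: eq_bigr => v _; rewrite -scalemxAr -scalemxAl entryZ.
by rewrite tensor_op_adj !tensor_opM entry_tensor_op.
Qed.


(** * Unitarity, partial trace and one-photon marginals *)

Lemma unitary_col_orthonormal (T : finType) (U : op R T) (hU : U \is unitarymx)
    (u v : T) :
  \sum_b entry U b u * (entry U b v)^* = (u == v)%:R.
Proof.
(* [unitarymx] gives orthonormal rows; the adjoint is used to reach the columns. *)
have /unitarymxP UtU : U^t* \is unitarymx by rewrite trmxC_unitary.
rewrite trmxCK in UtU.
have : entry (U^t* *m U) v u = (v == u)%:R.
  by rewrite UtU /entry mxE (inj_eq enum_rank_inj).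
rewrite entryM eq_sym => <-; apply: eq_bigr => b _.
by rewrite entry_adj mulrC.
Qed.

Lemma squash_matrix_unit n (j : 'I_n) (u v : qubits n) (b c : bool) :
  entry (squash j (ketbra R u v)) b c =
  [&& u j == b, v j == c & [forall k, (k != j) ==> (u k == v k)]]%:R.
Proof.
rewrite /entry mxE !enum_rankK.
transitivity (\sum_(x : qubits n | x == u) \sum_(y : qubits n | y == v)
  [&& x j == b, y j == c & [forall k, (k != j) ==> (x k == y k)]]%:R : C).
  rewrite big_mkcond [RHS]big_mkcond; apply: eq_bigr => x _.
  case: (eqVneq x u) => [->|xu].
    case: (u j == b); last by rewrite big1.
    rewrite big_mkcond [RHS]big_mkcond; apply: eq_bigr => y _.
    by rewrite -/(entry _ _ _) entry_ketbra eqxx /=; case: (y == v); case: ifP.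
  case: (_ == b) => //; apply: big1 => y _.
  by rewrite -/(entry _ _ _) entry_ketbra (negPf xu).
by rewrite !big_pred1_eq.
Qed.

Section Marginal.
Variables (U : op R bool) (hU : U \is unitarymx) (n : nat).
Implicit Types (j k : 'I_n) (u v : qubits n).

(** The contribution of [|u><v|] to finding photon [j] in [b]: the other photons are traced out, so
    [u] and [v] must agree there. *)
Definition marginal j b u v : C :=
  (entry U b (u j) * (entry U b (v j))^*) *
  [forall k, (k != j) ==> (u k == v k)]%:R.

(** [squash j] sends [|u><v|] to [|u j><v j|] if [u] and [v] agree off [j] and to 0 otherwise, so a
    single term survives. *)
Lemma squash_marginal j b u v :
  entry (U *m squash j (ketbra R u v) *m U^t*) b b = marginal j b u v.
Proof.
rewrite entry_conj (bigD1 (u j)) //= [X in _ + X]big1 ?addr0; last first.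
  move=> c /negPf cu; apply: big1 => d _.
  by rewrite squash_matrix_unit eq_sym cu mul0r.
rewrite (bigD1 (v j)) //= [X in _ + X]big1 ?addr0; last first.
  by move=> c /negPf cv; rewrite squash_matrix_unit [v j == c]eq_sym cv andbF mul0r.
by rewrite squash_matrix_unit !eqxx /= mulrC.
Qed.

Lemma on_each_total u v :
  \sum_x entry (on_each n U) x u * (entry (on_each n U) x v)^* = (u == v)%:R.
Proof.
transitivity (\prod_k \sum_b entry U b (u k) * (entry U b (v k))^*).
  rewrite bigA_distr_dffun; apply: eq_bigr => x _.
  by rewrite !entry_tensor_op rmorph_prod -big_split.
under eq_bigr => k _ do rewrite unitary_col_orthonormal //.
case: eqVneq => [->|uv]; first by rewrite big1 // => k _; rewrite eqxx.
apply/eqP/prodf_eq0.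
have [k uvk|uv0] := pickP (fun k => u k != v k); last first.
  by case/eqP: uv; apply/ffunP => k; have /negbFE/eqP := uv0 k.
by exists k; rewrite // (negPf uvk).
Qed.

Lemma on_each_marginal j b u v :
  \sum_(x : qubits n | x j == b)
    entry (on_each n U) x u * (entry (on_each n U) x v)^* = marginal j b u v.
Proof.
(* The condition fixes the outcome of photon [j] alone; every other photon is summed freely and
   gives a Kronecker delta. *)
transitivity (\prod_k \sum_(c | (k == j) ==> (c == b))
    entry U c (u k) * (entry U c (v k))^*).
  rewrite bigA_distr_dffun_cond; apply: eq_big => x.
    apply/idP/forallP => [xj k|/(_ j)]; last by rewrite eqxx.
    by apply/implyP => /eqP->.
  by move=> _; rewrite !entry_tensor_op rmorph_prod -big_split.
rewrite (bigD1 j) //= eqxx big_pred1_eq /marginal; congr (_ * _).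
transitivity (\prod_(k | k != j) (u k == v k)%:R : C).
  by apply: eq_bigr => k /negPf kj; rewrite kj /= (unitary_col_orthonormal hU).
have [/forallP uv|] := boolP [forall k, (k != j) ==> (u k == v k)].
  by rewrite big1 // => k kj; have /implyP/(_ kj) -> := uv k.
rewrite negb_forall => /existsP[m]; rewrite negb_imply => /andP[mj /negPf uvm].
by apply/eqP/prodf_eq0; exists m; rewrite ?uvm.
Qed.

End Marginal.

(** * Invariance of the state under photon permutations *)

Lemma density_hermitian (T : finType) (A : op R T) (hA : density A) (x y : T) :
  entry A y x = (entry A x y)^*.
Proof. by rewrite {1}(psd_hermitian hA.1) entry_adj. Qed.

Definition permute n (s : 'S_n) (x : qubits n) : qubits n :=
  [ffun j => x (s j)].

Section Symmetry.
Variables (N : nat) (n : 'I_N -> nat) (rho : op R (signals n)).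
Variable (hrho : joint_state rho).
Implicit Types (s : forall l, 'S_(n l)) (u v : signals n).

Definition permute_signals s u : signals n := [ffun l => permute (s l) (u l)].

Lemma permute_signals_bij s : bijective (permute_signals s).
Proof.
exists (permute_signals (fun l => (s l)^-1%g)) => x; apply/ffunP => l;
  by apply/ffunP => j; rewrite !ffunE ?permK ?permKV.
Qed.

Lemma tensor_symmetric_permute s (v : ket R (signals n)) u :
  tensor_symmetric v -> amplitude v (permute_signals s u) = amplitude v u.
Proof.
case=> m [psi [psi_sym ->]]; rewrite /amplitude !summxE.
apply: eq_bigr => k _; rewrite !mxE !enum_rankK; apply: eq_bigr => l _.
by rewrite ffunE; apply: psi_sym.
Qed.

Lemma joint_state_permutel s u v :
  entry rho (permute_signals s u) v = entry rho u v.
Proof.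
(* Column [v] of [rho] is the image of a basis vector, hence symmetric. *)
have := tensor_symmetric_permute s u (hrho.2 (delta_mx (enum_rank v) 0)).
by rewrite /amplitude -colE !mxE.
Qed.

(** Symmetry of the range only concerns rows; Hermitian symmetry carries it over to columns. *)
Lemma joint_state_permute s u v :
  entry rho (permute_signals s u) (permute_signals s v) = entry rho u v.
Proof.
rewrite joint_state_permutel (density_hermitian hrho.1) joint_state_permutel.
by rewrite -(density_hermitian hrho.1).
Qed.

End Symmetry.

Lemma marginal_permute (U : op R bool) n (s : 'S_n) (j : 'I_n) b
    (u v : qubits n) :
  marginal U j b (permute s u) (permute s v) = marginal U (s j) b u v.
Proof.
rewrite /marginal !ffunE; congr (_ * _%:R); congr (nat_of_bool _).
apply/forallP/forallP => uv k.
  have := uv (s^-1%g k); rewrite !ffunE permKV; congr (~~ _ ==> _).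
  by rewrite -(inj_eq (@perm_inj _ s)) permKV.
by have := uv (s k); rewrite !ffunE (inj_eq perm_inj).
Qed.

(** * Threshold outcomes and the error rate *)

Lemma threshold_eq_bit n (k : record n) (b i : bool) :
  k b != 0%N :> nat -> threshold k = SingleClick i -> i = b.
Proof.
rewrite /threshold; case: ifP => [k1 kb [<-]|_].
  by case: b kb => //; rewrite k1.
by case: ifP => // k0 kb [<-]; case: b kb => //; rewrite k0.
Qed.

(** A single click forces the bit, so only double clicks leave it open: errors include all erroneous
    single clicks and otherwise occur only at double clicks. *)
Lemma error_rate_bounds (N : nat) (n : 'I_N -> nat) (a : 'I_N -> bool)
    (k : records n) (y : qubits N) :
  (forall l, k l (y l) != 0%N :> nat) ->
  (N_se a k)%:R / N%:R <= error_rate R a y <= (N_se a k + N_d k)%:R / N%:R.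
Proof.
move=> ky; rewrite /error_rate !ler_wpM2r ?invr_ge0 ?ler0n ?ler_nat //.
  apply: leq_trans (leq_card_setU _ _); apply/subset_leq_card/subsetP => l.
  rewrite !inE; case E: (threshold (k l)) => [i|]; last by rewrite orbT.
  by rewrite /= -(threshold_eq_bit (ky l) E) => ->.
apply/subset_leq_card/subsetP => l; rewrite !inE.
case E: (threshold (k l)) => [i|] //=.
by rewrite -(threshold_eq_bit (ky l) E).
Qed.

(** * The law of records and bits *)

Section Detection.
Variables (N : nat) (n : 'I_N -> nat) (U : op R bool) (hU : U \is unitarymx).
Variables (rho : op R (signals n)) (hrho : joint_state rho).
Local Notation V := (tensor_op (fun l => on_each (n l) U)).
Implicit Types (x u v : signals n) (y : qubits N) (J : forall l, 'I_(n l)).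

Lemma born_marginal J y :
  \sum_(x : signals n | [forall l, x l (J l) == y l]) born V rho x =
  complex.Re (\sum_u \sum_v entry rho u v *
    \prod_l marginal U (J l) (y l) (u l) (v l)).
Proof.
rewrite (born_tensor_op_sum (fun l (t : qubits (n l)) => t (J l) == y l)).
congr complex.Re; apply: eq_bigr => u _; apply: eq_bigr => v _.
by congr (_ * _); apply: eq_bigr => l _; apply: on_each_marginal.
Qed.

Lemma born_marginal_indep J J' y :
  \sum_(x : signals n | [forall l, x l (J l) == y l]) born V rho x =
  \sum_(x : signals n | [forall l, x l (J' l) == y l]) born V rho x.
Proof.
rewrite !born_marginal; congr complex.Re.
(* Applied to both indices, these transpositions fix the entries of [rho] and move the observed
   photon from [J l] to [J' l]. *)
pose s l := tperm (J l) (J' l).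
rewrite [LHS](reindex (permute_signals s)); last first.
  exact/onW_bij/permute_signals_bij.
apply: eq_bigr => u _.
rewrite [LHS](reindex (permute_signals s)); last first.
  exact/onW_bij/permute_signals_bij.
apply: eq_bigr => v _; rewrite joint_state_permute //; congr (_ * _).
apply: eq_bigr => l _; rewrite [permute_signals s u l]ffunE.
by rewrite [permute_signals s v l]ffunE marginal_permute tpermL.
Qed.

Lemma born_squash J y :
  \sum_(x : signals n | [forall l, x l (J l) == y l]) born V rho x =
  born (on_each N U) (tensor_map (fun l => squash (J l)) rho) y.
Proof.
rewrite born_marginal born_tensor_map; congr complex.Re.
apply: eq_bigr => u _; apply: eq_bigr => v _; congr (_ * _).
by apply: eq_bigr => l _; rewrite squash_marginal.
Qed.

(** Without a constraint each factor is a Kronecker delta, which leaves the trace of [rho]. *)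
Lemma born_total : \sum_x born V rho x = 1.
Proof.
transitivity (\sum_(x : signals n | [forall l, xpredT (x l)]) born V rho x).
  by apply: eq_bigl => x; apply/esym/forallP.
rewrite (born_tensor_op_sum (fun l => xpredT)).
transitivity (complex.Re (\tr rho)); last by rewrite hrho.1.2.
congr complex.Re; rewrite /mxtrace big_ord_enum_rank; apply: eq_bigr => u _.
rewrite (bigD1 u) //= [X in _ + X]big1 ?addr0 => [|v vu].
  by rewrite big1 ?mulr1 // => l _; rewrite on_each_total // eqxx.
have [l uvl|uv] := pickP (fun l => u l != v l); last first.
  case/eqP: vu; apply/ffunP => l; apply/esym/eqP/negbFE; exact: uv.
by rewrite (bigD1 l) //= on_each_total // (negPf uvl) mul0r mulr0.
Qed.

Definition count_signals x : records n := [ffun l => count_photons (x l)].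

Lemma count_photonsE m (x : qubits m) b :
  (count_photons x b)%:R = \sum_(j < m) (x j == b)%:R :> R.
Proof.
rewrite ffunE inordK ?ltnS; last by rewrite -[leqRHS]card_ord max_card.
by rewrite -sum1dep_card natr_sum big_mkcond; apply: eq_bigr => j _; case: eqP.
Qed.

(** Conditional probability of the bits [y] given the individual photon outcomes [x]. *)
Definition bit_weight x y : R :=
  \prod_l ((count_photons (x l) (y l))%:R / (n l)%:R).

(** Records only group the outcomes [x] by their counts, on which the weight depends; the grouping
    can be undone. *)
Lemma Pr_detection (E : pred (records n * qubits N)) :
  Pr (detection_law U rho) E =
  \sum_x born V rho x * \sum_(y | E (count_signals x, y)) bit_weight x y.
Proof.
rewrite /Pr /detection_law.
rewrite (eq_bigl (fun w => xpredT w.1 && E (w.1, w.2))); last by case.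
rewrite -(pair_big_dep xpredT (fun k y => E (k, y))
  (fun k y => record_law U rho k * \prod_l ((k l (y l))%:R / (n l)%:R))) /=.
rewrite [RHS](partition_big count_signals xpredT) //=; apply: eq_bigr => k _.
rewrite -big_distrr /record_law big_distrl /=; apply: eq_big => x.
  apply/forallP/eqP => [xk|<- l]; last by rewrite ffunE.
  by apply/ffunP => l; rewrite ffunE; apply/eqP/xk.
move=> /forallP xk.
have -> : k = count_signals x.
  by apply/ffunP => l; rewrite ffunE; apply/esym/eqP/xk.
congr (_ * _); apply: eq_bigr => y _; apply: eq_bigr => l _.
by rewrite ffunE.
Qed.

Hypothesis hn : forall l, (0 < n l)%N.

Lemma bit_weight_total x : \sum_y bit_weight x y = 1.
Proof.
rewrite -(bigA_distr_dffun
  (fun l b => (count_photons (x l) b)%:R / (n l)%:R)) big1 // => l _.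
rewrite -big_distrl /=.
under eq_bigr => b _ do rewrite count_photonsE.
rewrite exchange_big (eq_bigr (fun=> 1)) => [|j _].
  by rewrite sumr_const card_ord divff // pnatr_eq0 -lt0n.
rewrite (bigD1 (x l j)) //= eqxx big1 ?addr0 // => b /negPf.
by rewrite eq_sym => ->.
Qed.

Lemma Pr_bits J y :
  Pr (detection_law U rho) (fun w => w.2 == y) =
  \sum_(x : signals n | [forall l, x l (J l) == y l]) born V rho x.
Proof.
rewrite Pr_detection /=.
under eq_bigr => x _ do rewrite big_pred1_eq.
(* [c] is the uniform law on the choices [K] of one photon per signal. *)
pose c l (j : 'I_(n l)) : R := (n l)%:R^-1.
transitivity (\sum_(K : {dffun forall l, 'I_(n l)}) \prod_l c l (K l) *
    \sum_(x : signals n | [forall l, x l (J l) == y l]) born V rho x).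
  (* Each term may observe its own photons [K] instead of [J]. *)
  under [RHS]eq_bigr => K _ do
    rewrite -(born_marginal_indep K) [X in _ * X]big_mkcond big_distrr /=.
  rewrite exchange_big; apply: eq_bigr => x _ /=.
  rewrite /bit_weight.
  (* Counts are sums of indicators, so their product expands into a sum over the choices [K]. *)
  under eq_bigr => l _ do rewrite count_photonsE big_distrl /=.
  rewrite (bigA_distr_dffun (fun l j => (x l j == y l)%:R / (n l)%:R)).
  rewrite big_distrr; apply: eq_bigr => K _ /=.
  rewrite big_split /= mulrA [RHS]mulrC.
  congr (_ * _); case: ifPn => [/forallP xy|].
    by rewrite big1 ?mulr1 // => l _; rewrite xy.
  rewrite negb_forall => /existsP[l /negPf xyl].
  by rewrite (bigD1 l) //= xyl mul0r mulr0.
rewrite -mulr_suml -bigA_distr_dffun big1 ?mul1r // => l _.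
by rewrite sumr_const card_ord -[LHS]mulr_natr mulVf // pnatr_eq0 -lt0n.
Qed.

End Detection.

End Operators.

Theorem corollary1 (R : realType) (N : nat) (hN : (0 < N)%N)
    (n : 'I_N -> nat) (hn : forall l, (0 < n l)%N)
    (rho : op R (signals n)) (hrho : joint_state rho)
    (U : op R bool) (hU : U \is unitarymx) (a : 'I_N -> bool) :
  (forall (j : forall l, 'I_(n l)) (y : qubits N),
     Pr (detection_law U rho) (fun w => w.2 == y) =
     born (on_each N U) (tensor_map (fun l => squash (j l)) rho) y)
  /\
  Pr (detection_law U rho)
     (fun w => (N_se a w.1)%:R / N%:R <= error_rate R a w.2
                 <= (N_se a w.1 + N_d w.1)%:R / N%:R) = 1.
Proof.
split=> [j y|]; first by rewrite (Pr_bits hU hrho hn j) born_squash.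
(* Writing 1 as the total mass over [x] and [y] leaves to show that bits violating the bounds have
   weight 0. *)
rewrite Pr_detection -[RHS](born_total hU hrho); apply: eq_bigr => x _.
rewrite -[RHS]mulr1; congr (_ * _); rewrite -[RHS](bit_weight_total R hn x).
rewrite big_mkcond; apply: eq_bigr => y _; case: ifPn => // Ny.
(* By contraposition: a nonzero weight makes the count at every [y l] nonzero. *)
apply/esym/eqP; apply: contraNT Ny => /prodf_neq0 xy /=.
apply: error_rate_bounds => l; rewrite ffunE.
by apply: contraNneq (xy l isT) => ->; rewrite mul0r.
Qed.
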